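(* Let $\mathcal{L}$ be a variety of lattice-ordered algebras. Then the free-algebra functor $F_{\mathcal{L}}:\mathrm{Set}\to\mathrm{Set}$ weakly preserves pullbacks of epis. That is: for all surjective maps $\alpha:X\to Z$ and $\beta:Y\to Z$ of sets, with pullback $Pb(\alpha,\beta)=\{(x,y)\in X\times Y\mid \alpha x=\beta y\}$ and coordinate projections $\pi_1:Pb(\alpha,\beta)\to X$, $\pi_2:Pb(\alpha,\beta)\to Y$, the square consisting of $F_{\mathcal{L}}\pi_1, F_{\mathcal{L}}\pi_2, F_{\mathcal{L}}\alpha, F_{\mathcal{L}}\beta$ is a weak pullback in $\mathrm{Set}$.
   Context: A variety of lattice-ordered algebras is a variety $\mathcal{L}$ of algebras with finitary operations whose signature contains binary operations $\vee,\wedge$ satisfying the lattice axioms, and such that in every algebra of $\mathcal{L}$ all additional operations are monotone in each argument with respect to the lattice order. For a set $X$, $F_{\mathcal{L}}(X)$ denotes (the underlying set of) the algebra in $\mathcal{L}$ freely generated by $X$; for a map $f:X\to Y$, $F_{\mathcal{L}}f=\bar f:F_{\mathcal{L}}(X)\to F_{\mathcal{L}}(Y)$ is the unique homomorphism extending $X\xrightarrow{f}Y\hookrightarrow F_{\mathcal{L}}(Y)$. This makes $F_{\mathcal{L}}$ a functor $\mathrm{Set}\to\mathrm{Set}$. A commutative square $\alpha'\circ\eta_1=\beta'\circ\eta_2$ (with $\eta_1:Q\to X'$, $\eta_2:Q\to Y'$, $\alpha':X'\to Z'$, $\beta':Y'\to Z'$) is a weak pullback if every pair of maps $\theta_1:R\to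 X'$, $\theta_2:R\to Y'$ with $\alpha'\circ\theta_1=\beta'\circ\theta_2$ factors as $\theta_i=\eta_i\circ d$ $(i=1,2)$ for some (not necessarily unique) $d:R\to Q$. In $\mathrm{Set}$ this is equivalent to: for all $p\in X'$, $q\in Y'$ with $\alpha' p=\beta' q$ there is $s\in Q$ with $\eta_1 s=p$ and $\eta_2 s=q$. *)

(* Defs.v *)
(* MathComp world, with the classical axioms of mathcomp.classical.boolp. *)
From mathcomp Require Import all_boot.
From mathcomp Require Import boolp.

Set Implicit Arguments.
Unset Strict Implicit.
Unset Printing Implicit Defensive.

Record signature := Signature {
  symbol : Type;
  arity : symbol -> nat }.

(* Carriers may be empty: without constants, the free algebra on the empty set
   is empty. *)
Record algebra (S : signature) := Algebra {
  carrier :> Type;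
  interp : forall s : symbol S, ('I_(arity s) -> carrier) -> carrier }.

Definition is_hom (S : signature) (A B : algebra S) (h : A -> B) : Prop :=
  forall (s : symbol S) (a : 'I_(arity s) -> A),
    h (interp a) = interp (fun i => h (a i)).

Inductive term (S : signature) (V : Type) : Type :=
| Var of V
| App (s : symbol S) of ('I_(arity s) -> term S V).

Fixpoint eval (S : signature) (V : Type) (A : algebra S) (v : V -> A)
    (t : term S V) : A :=
  match t with
  | Var x => v x
  | App s args => interp (fun i => eval v (args i))
  end.

(* A variety is presented by a set of identities in countably many variables. *)
Definition variety (S : signature) := term S nat -> term S nat -> Prop.

Definition in_variety (S : signature) (L : variety S) (A : algebra S) : Prop :=
  forall l r : term S nat, L l r ->
  forall v : nat -> A, eval v l = eval v r.

(* The value of a binary symbol; only meaningful when [arity s = 2]. *)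
Definition binop (S : signature) (A : algebra S) (s : symbol S) (x y : A) : A :=
  interp (s := s) (fun i => if i == 0 :> nat then x else y).

Definition lattice_axioms (T : Type) (j m : T -> T -> T) : Prop :=
  [/\ commutative j /\ associative j, commutative m /\ associative m,
      forall x y, j x (m x y) = x & forall x y, m x (j x y) = x].

Definition lattice_le (T : Type) (m : T -> T -> T) (x y : T) : Prop :=
  m x y = x.

Definition monotone_in_each_argument (T : Type) (le : T -> T -> Prop) (n : nat)
    (f : ('I_n -> T) -> T) : Prop :=
  forall (i : 'I_n) (a b : 'I_n -> T),
    (forall k, k != i -> a k = b k) -> le (a i) (b i) -> le (f a) (f b).

Record lattice_ordered_variety (S : signature) (L : variety S)
    (join meet : symbol S) : Prop := LatticeOrderedVariety {
  arity_join : arity join = 2;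
  arity_meet : arity meet = 2;
  lov_lattice : forall A : algebra S, in_variety L A ->
    lattice_axioms (@binop S A join) (@binop S A meet);
  lov_monotone : forall A : algebra S, in_variety L A ->
    forall s : symbol S, s <> join -> s <> meet ->
    monotone_in_each_argument (lattice_le (@binop S A meet))
      (@interp S A s) }.

Record free_algebra (S : signature) (L : variety S) (X : Type) := FreeAlgebra {
  free_alg :> algebra S;
  free_in : in_variety L free_alg;
  free_gen : X -> free_alg;
  free_univ : forall A : algebra S, in_variety L A -> forall f : X -> A,
    exists! h : free_alg -> A,
      is_hom h /\ (forall x : X, h (free_gen x) = f x) }.

Arguments free_in {S L X} _.
Arguments free_gen {S L X} _ _.
Arguments free_univ {S L X} _ {A} _ _.

Definition free_lift (S : signature) (L : variety S) (X : Type)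
    (FX : free_algebra L X) (A : algebra S) (LA : in_variety L A)
    (f : X -> A) : FX -> A :=
  sval (cid (free_univ FX LA f)).

Arguments free_lift {S L X} FX {A} LA f.

(* [F] is any choice of a free algebra on every set; [Fmap F] is the action on
   maps of the resulting functor. *)
Definition Fmap (S : signature) (L : variety S)
    (F : forall X : Type, free_algebra L X) (X Y : Type) (f : X -> Y) :
    F X -> F Y :=
  free_lift (F X) (free_in (F Y)) (fun x => free_gen (F Y) (f x)).

Arguments Fmap {S L} F {X Y} f _.

Definition surjective_map (X Y : Type) (f : X -> Y) : Prop :=
  forall y : Y, exists x : X, f x = y.

Definition Pb (X Y Z : Type) (alpha : X -> Z) (beta : Y -> Z) : Type :=
  {p : X * Y | alpha p.1 = beta p.2}.

Definition Pb1 (X Y Z : Type) (alpha : X -> Z) (beta : Y -> Z)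
    (p : Pb alpha beta) : X := (sval p).1.

Definition Pb2 (X Y Z : Type) (alpha : X -> Z) (beta : Y -> Z)
    (p : Pb alpha beta) : Y := (sval p).2.

Definition is_weak_pullback (Q X Y Z : Type) (eta1 : Q -> X) (eta2 : Q -> Y)
    (alpha : X -> Z) (beta : Y -> Z) : Prop :=
  alpha \o eta1 = beta \o eta2 /\
  forall (R : Type) (theta1 : R -> X) (theta2 : R -> Y),
    alpha \o theta1 = beta \o theta2 ->
    exists d : R -> Q, theta1 = eta1 \o d /\ theta2 = eta2 \o d.

Section FreeAlgebraFacts.
Variables (S : signature) (L : variety S).

Lemma free_liftP (X : Type) (FX : free_algebra L X) (A : algebra S)
    (LA : in_variety L A) (f : X -> A) :
  is_hom (free_lift FX LA f) /\
  (forall x, free_lift FX LA f (free_gen FX x) = f x).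
Proof. by rewrite /free_lift; case: cid => h []. Qed.

Lemma free_lift_uniq (X : Type) (FX : free_algebra L X) (A : algebra S)
    (LA : in_variety L A) (f : X -> A) (h : FX -> A) :
  is_hom h -> (forall x, h (free_gen FX x) = f x) -> free_lift FX LA f = h.
Proof. by move=> hh hf; rewrite /free_lift; case: cid => g [_ /=]; apply. Qed.

Lemma Fmap_id (F : forall X : Type, free_algebra L X) (X : Type) :
  Fmap F (@id X) = id.
Proof. exact: free_lift_uniq. Qed.

Lemma Fmap_comp (F : forall X : Type, free_algebra L X) (X Y Z : Type)
    (g : Y -> Z) (f : X -> Y) :
  Fmap F (g \o f) = Fmap F g \o Fmap F f.
Proof.
rewrite /Fmap; apply: free_lift_uniq => [s a|x] /=.
  by rewrite (free_liftP _ _ _).1 (free_liftP _ _ _).1.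
by rewrite (free_liftP _ _ _).2 (free_liftP _ _ _).2.
Qed.

Lemma eval_hom (V : Type) (A B : algebra S) (h : A -> B) (v : V -> A)
    (t : term S V) :
  is_hom h -> h (eval v t) = eval (fun x => h (v x)) t.
Proof.
move=> hh; elim: t => [x|s a IH] //=.
by rewrite hh; congr interp; apply: funext.
Qed.

(* Free algebras exist: terms modulo the identities valid in [L]. *)
Section Existence.
Variable X : Type.

Definition term_equiv (t u : term S X) : Prop :=
  forall A : algebra S, in_variety L A -> forall v : X -> A,
    eval v t = eval v u.

Definition term_class : Type :=
  {P : term S X -> Prop | exists t, P = term_equiv t}.

Definition class_of (t : term S X) : term_class :=
  exist _ (term_equiv t) (ex_intro _ t erefl).

Definition class_repr (c : term_class) : term S X := sval (cid (svalP c)).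

Lemma class_reprK (c : term_class) : class_of (class_repr c) = c.
Proof.
rewrite /class_repr; case: cid => t /=; case: c => P hP /= ePt.
exact/eq_exist.
Qed.

Lemma class_ofP (t u : term S X) : class_of t = class_of u <-> term_equiv t u.
Proof.
split=> [[e]|e].
  have : term_equiv u u by [].
  by rewrite -{1}e.
apply/eq_exist/funext => w; apply/propext.
by split=> h A LA v; [rewrite -e // h|rewrite e // h].
Qed.

Definition term_alg : algebra S :=
  Algebra (fun s (a : 'I_(arity s) -> term_class) =>
    class_of (App (fun i => class_repr (a i)))).

Fixpoint subst (V : Type) (v : V -> term S X) (t : term S V) : term S X :=
  match t with
  | Var x => v x
  | App s a => App (fun i => subst v (a i))
  end.

Lemma eval_subst (V : Type) (v : V -> term S X) (A : algebra S) (w : X -> A)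
    (t : term S V) :
  eval w (subst v t) = eval (fun x => eval w (v x)) t.
Proof.
by elim: t => [x|s a IH] //=; congr interp; apply: funext.
Qed.

Lemma class_repr_of (t : term S X) : term_equiv (class_repr (class_of t)) t.
Proof. by apply/class_ofP; rewrite class_reprK. Qed.

Lemma eval_term_alg (V : Type) (v : V -> term_alg) (t : term S V) :
  eval v t = class_of (subst (fun x => class_repr (v x)) t).
Proof.
elim: t => [x|s a IH] /=; first by rewrite class_reprK.
apply/class_ofP => A LA w /=; congr interp; apply: funext => i.
by rewrite IH class_repr_of.
Qed.

Lemma term_alg_in : in_variety L term_alg.
Proof.
move=> l r Llr v; rewrite !eval_term_alg; apply/class_ofP => A LA w.
by rewrite !eval_subst; apply: LA.
Qed.

Lemma term_alg_univ (A : algebra S) : in_variety L A -> forall f : X -> A,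
  exists! h : term_alg -> A,
    is_hom h /\ (forall x : X, h (class_of (Var S x)) = f x).
Proof.
move=> LA f; exists (fun c => eval f (class_repr c)); split.
  by split=> [s a|x]; rewrite /= class_repr_of.
move=> h [hh hf]; apply: funext => c; rewrite -[in RHS](class_reprK c).
elim: (class_repr c) => [x|s a IH] //=.
have -> : class_of (App a) = @interp S term_alg s (fun i => class_of (a i)).
  apply/class_ofP => B LB w /=; congr interp; apply: funext => i.
  by rewrite class_repr_of.
by rewrite hh; congr interp; apply: funext.
Qed.

Definition term_free_algebra : free_algebra L X :=
  FreeAlgebra term_alg_in term_alg_univ.

End Existence.
End FreeAlgebraFacts.

(* Main.v *)
Require Import Defs.
From mathcomp Require Import all_boot.
From mathcomp Require Import boolp.

(** Let [alpha : X -> Z] and [beta : Y -> Z] be onto, and let [p] in [F X] and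
[q] in [F Y] have the same image in [F Z].  It suffices to find [s1] and [s2]
in [F (Pb alpha beta)] such that

  - [s1] projects exactly onto [p] and to an element below [q];
  - [s2] projects exactly onto [q] and to an element below [p].

The join [s1 \/ s2] then projects onto [p] and onto [q], because each
projection is a homomorphism and absorbs the smaller of the two joinands
([free_functor_weak_pullback]).

The construction of [s1] is [exact_left_below_right].  If the fibres of [beta]
are finite, substitute for each [x] in [p] the meet of all pairs [(x, y)] of
the pullback.  The first projection of this meet is [x], by idempotency.
The second projection is the meet of the fibre of [beta] over [alpha x]; as it
only depends on [alpha x], the second projection of [s1] can be computed from
the common image of [p] and [q] in [F Z], and so it equals the result of
replacing each [y] in [q] by the meet of its own fibre.  That meet is below
[y], and all operations are monotone, so the result is below [q].

When fibres are infinite, only the finitely many generators on which [q]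
depends need to lie above the chosen meets ([finitely_supported_free]), so
meets of finitely many elements of each fibre are enough.  Surjectivity of
[beta] makes these finite meets nonempty. *)

Set Implicit Arguments.
Unset Strict Implicit.
Unset Printing Implicit Defensive.

(** * Lattices presented by their operations *)

Section Lattice.
Variables (T : Type) (j m : T -> T -> T).
Hypothesis lat : lattice_axioms j m.

Lemma lattice_le_refl x : lattice_le m x x.
Proof. by case: lat => _ _ jmK mjK; rewrite /lattice_le -{2}(jmK x x) mjK. Qed.

Lemma lattice_le_trans x y z :
  lattice_le m x y -> lattice_le m y z -> lattice_le m x z.
Proof.
by case: lat => _ [_ mA] _ _; rewrite /lattice_le => <- yz; rewrite -mA yz.
Qed.

Lemma meet_lel x y : lattice_le m (m x y) x.
Proof.
by case: lat => _ [mC mA] _ _; rewrite /lattice_le mC mA lattice_le_refl.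
Qed.

Lemma meet_ler x y : lattice_le m (m x y) y.
Proof. by case: lat => _ [mC mA] _ _; rewrite mC; apply: meet_lel. Qed.

Lemma le_joinP x y : lattice_le m x y <-> j x y = y.
Proof.
case: lat => [[jC _] [mC _] jmK mjK]; rewrite /lattice_le.
by split=> <-; [rewrite jC mC jmK|rewrite mjK].
Qed.

Lemma meet_mono x x' y y' : lattice_le m x x' -> lattice_le m y y' ->
  lattice_le m (m x y) (m x' y').
Proof.
case: lat => _ [mC mA] _ _ xx' yy'.
by rewrite /lattice_le mA -(mA x) (mC y) (mA x) xx' -mA yy'.
Qed.

Lemma join_mono x x' y y' : lattice_le m x x' -> lattice_le m y y' ->
  lattice_le m (j x y) (j x' y').
Proof.
case: lat => [[jC jA] _ _ _] /le_joinP xx' /le_joinP yy'; apply/le_joinP.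
by rewrite jA -(jA x) (jC y) (jA x) xx' -jA yy'.
Qed.

Lemma foldr_meet_le a (I : eqType) (f : I -> T) (s : seq I) i : i \in s ->
  lattice_le m (foldr m a [seq f k | k <- s]) (f i).
Proof.
elim: s => //= k s IH; rewrite inE => /orP[/eqP ->|/IH]; first exact: meet_lel.
by apply: lattice_le_trans; apply: meet_ler.
Qed.

Lemma foldr_meet_const a (I : Type) (s : seq I) :
  foldr m a [seq a | _ <- s] = a.
Proof. by elim: s => //= _ s ->; apply: lattice_le_refl. Qed.

(** Monotonicity in all arguments at once: pass from [a] to [b] by changing one
argument at a time, in increasing order. *)
Lemma monotone_pointwise n (f : ('I_n -> T) -> T) (a b : 'I_n -> T) :
  monotone_in_each_argument (lattice_le m) f ->
  (forall i, lattice_le m (a i) (b i)) -> lattice_le m (f a) (f b).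
Proof.
move=> fmono ab.
pose c k (i : 'I_n) := if i < k then b i else a i.
suff H k : k <= n -> lattice_le m (f a) (f (c k)).
  have -> : b = c n by apply: funext => i; rewrite /c ltn_ord.
  exact: H.
elim: k => [_|k IH kn].
  have -> : c 0 = a by apply: funext.
  exact: lattice_le_refl.
apply: lattice_le_trans (IH (ltnW kn)) _.
apply: (fmono (Ordinal kn)) => [i|]; last by rewrite /c /= ltnn ltnSn.
rewrite -val_eqE /c /= ltnS [i <= k]leq_eqVlt => /negbTE -> //.
Qed.

End Lattice.

(** * Free algebras *)

Section Free.
Variables (S : signature) (L : variety S).

Lemma free_lift_gen (X : Type) (FX : free_algebra L X) q :
  free_lift FX (free_in FX) (free_gen FX) q = q.
Proof. by rewrite (free_lift_uniq (free_in FX) (h := id)). Qed.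

(** The elements satisfying [P] form a subalgebra containing the generators;
by uniqueness, the identity of the free algebra factors through it. *)
Lemma free_algebra_ind (X : Type) (FX : free_algebra L X) (P : FX -> Prop) :
  (forall x, P (free_gen FX x)) ->
  (forall s (a : 'I_(arity s) -> FX), (forall i, P (a i)) -> P (interp a)) ->
  forall q, P q.
Proof.
move=> Pgen Pop q.
pose B : algebra S := @Algebra S {q : FX | P q} (fun s a =>
  exist P (interp (fun i => sval (a i))) (Pop s _ (fun i => svalP (a i)))).
have Bsval : @is_hom S B FX sval by [].
have LB : in_variety L B.
  have sval_inj : forall u w : B, sval u = sval w -> u = w.
    by move=> [u Pu] [w Pw] /= uw; apply/eq_exist.
  move=> l r Llr v; apply: sval_inj.
  by rewrite !(eval_hom _ _ Bsval); apply: (free_in FX).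
pose h := free_lift FX LB (fun x => exist P (free_gen FX x) (Pgen x)).
have [hh hgen] := free_liftP FX LB (fun x => exist P (free_gen FX x) (Pgen x)).
suff <- : sval (h q) = q by apply: svalP.
have hom_sval : is_hom (fun u => sval (h u)) by move=> s a; rewrite /h hh.
rewrite -[RHS]free_lift_gen (free_lift_uniq _ hom_sval) // => x.
by rewrite /h hgen.
Qed.

Lemma hom_comp_lift (X : Type) (FX : free_algebra L X) (A B : algebra S)
    (LA : in_variety L A) (LB : in_variety L B) (f : X -> A) (h : A -> B) q :
  is_hom h -> h (free_lift FX LA f q) = free_lift FX LB (h \o f) q.
Proof.
move=> hh; have [lh lf] := free_liftP FX LA f.
rewrite (free_lift_uniq LB (h := h \o free_lift FX LA f)) // => [s a|x] /=.
  by rewrite lh hh.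
by rewrite lf.
Qed.

Variable F : forall X : Type, free_algebra L X.

Lemma Fmap_hom (X Y : Type) (f : X -> Y) : is_hom (Fmap F f).
Proof. exact: (free_liftP (F X) _ _).1. Qed.

Lemma Fmap_gen (X Y : Type) (f : X -> Y) x :
  Fmap F f (free_gen (F X) x) = free_gen (F Y) (f x).
Proof. exact: (free_liftP (F X) _ _).2. Qed.

Lemma free_lift_Fmap (X Y : Type) (f : X -> Y) (A : algebra S)
    (LA : in_variety L A) (g : Y -> A) q :
  free_lift (F Y) LA g (Fmap F f q) = free_lift (F X) LA (g \o f) q.
Proof.
have [lh lg] := free_liftP (F Y) LA g.
rewrite (hom_comp_lift _ LA) //; congr (free_lift _ _ _ q).
by apply: funext => x /=; rewrite lg.
Qed.

End Free.

Lemma hom_binop (S : signature) (A B : algebra S) (h : A -> B) s x y :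
  is_hom h -> h (binop s x y) = binop s (h x) (h y).
Proof. by move=> hh; rewrite hh; congr interp; apply: funext => i; case: ifP. Qed.

Lemma hom_foldr_binop (S : signature) (A B : algebra S) (h : A -> B) s a
    (I : Type) (f : I -> A) (l : seq I) :
  is_hom h -> h (foldr (binop s) a [seq f i | i <- l]) =
              foldr (binop s) (h a) [seq h (f i) | i <- l].
Proof. by move=> hh; elim: l => //= i l IH; rewrite hom_binop // IH. Qed.

Lemma interp_binop (S : signature) (A : algebra S) (s : symbol S)
    (i0 i1 : 'I_(arity s)) (a : 'I_(arity s) -> A) :
  arity s = 2 -> i0 = 0 :> nat -> i1 = 1 :> nat ->
  interp a = binop s (a i0) (a i1).
Proof.
move=> s2 i00 i11; congr interp; apply: funext => i.
case: eqP => i_eq; congr a; apply: val_inj; rewrite /= ?i00 ?i11 //.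
by have := ltn_ord i; rewrite {2}s2; case: (val i) i_eq => [|[]].
Qed.

(** * Lattice-ordered varieties *)

Section LatticeOrdered.
Variables (S : signature) (L : variety S) (join meet : symbol S).
Hypothesis HL : lattice_ordered_variety L join meet.

Local Notation le A := (lattice_le (@binop S A meet)).

Lemma interp_mono (A : algebra S) (s : symbol S) (a b : 'I_(arity s) -> A) :
  in_variety L A -> (forall i, le A (a i) (b i)) ->
  le A (interp a) (interp b).
Proof.
move=> LA ab; have lat := lov_lattice HL LA.
have binary : arity s = 2 -> exists i0 i1, forall c : 'I_(arity s) -> A,
    interp c = binop s (c i0) (c i1).
  move=> s2; have s0 : 0 < arity s by rewrite s2.
  have s1 : 1 < arity s by rewrite s2.
  by exists (Ordinal s0), (Ordinal s1) => c; apply: interp_binop.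
case: (pselect (s = join)) => [sE|s_join].
  have [|i0 [i1 E]] := binary; first by rewrite sE (arity_join HL).
  by rewrite !E sE; apply: (join_mono lat).
case: (pselect (s = meet)) => [sE|s_meet].
  have [|i0 [i1 E]] := binary; first by rewrite sE (arity_meet HL).
  by rewrite !E sE; apply: (meet_mono lat).
by apply: (monotone_pointwise lat) => //; apply: (lov_monotone HL).
Qed.

(** Stands in for the finitely many variables of a term denoting [q]: to
compare the values of [q] under two substitutions, it is enough to compare the
substitutions on a finite set of generators. *)
Lemma finitely_supported_free (Y : Type) (FY : free_algebra L Y)
    (A : algebra S) (LA : in_variety L A) (q : FY) :
  exists l : seq {classic Y}, forall f g : Y -> A,
    (forall y, y \in l -> le A (f y) (g y)) ->
    le A (free_lift FY LA f q) (free_lift FY LA g q).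
Proof.
elim/free_algebra_ind: q => [y|s a /choice[l lP]].
  exists [:: (y : {classic Y})] => f g fg.
  by rewrite !(free_liftP FY LA _).2; apply/fg/mem_head.
exists (flatten [seq l i | i <- enum 'I_(arity s)]) => f g fg.
rewrite !(free_liftP FY LA _).1; apply: interp_mono => // i.
apply: lP => y yl; apply: fg; apply/flatten_mapP; exists i => //.
by rewrite mem_enum.
Qed.

Variable F : forall X : Type, free_algebra L X.

(** [Q] stands for the pullback of [alpha] and [beta] or for its transpose: the
two elements needed for the join are obtained by exchanging the projections.
The meets substituted for the generators of [X] are constant in the first
coordinate and range over a fibre of [beta] in the second. *)
Lemma exact_left_below_right (Q X Y Z : Type) (eta1 : Q -> X) (eta2 : Q -> Y)
    (alpha : X -> Z) (beta : Y -> Z) (p : F X) (q : F Y) :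
  surjective_map beta ->
  (forall x y, alpha x = beta y -> exists w, eta1 w = x /\ eta2 w = y) ->
  Fmap F alpha p = Fmap F beta q ->
  exists s : F Q, Fmap F eta1 s = p /\ le (F Y) (Fmap F eta2 s) q.
Proof.
move=> /choice[gamma gammaK] pairs pq.
have lat := lov_lattice HL (free_in (F Y)).
have [l lP] := finitely_supported_free (free_in (F Y)) q.
(* [snap z] retracts [Y] onto the fibre over [z]: elements outside that fibre
   go to [gamma z], so every fibre receives a finite nonempty list of elements
   that contains each member of [l] lying in it. *)
pose snap z y := if `[< beta y = z >] then y else gamma z.
have snapE z y : beta (snap z y) = z by rewrite /snap; case: asboolP.
have /choice[pair pairP] : forall xy : X * Y, exists w,
    eta1 w = xy.1 /\ eta2 w = snap (alpha xy.1) xy.2.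
  by move=> xy; apply: pairs; rewrite snapE.
pose a x := foldr (binop meet) (free_gen (F Q) (pair (x, gamma (alpha x))))
  [seq free_gen (F Q) (pair (x, y)) | y <- l].
pose c z := foldr (binop meet) (free_gen (F Y) (snap z (gamma z)))
  [seq free_gen (F Y) (snap z y) | y <- l].
exists (free_lift (F X) (free_in (F Q)) a p); split.
  rewrite (hom_comp_lift _ (free_in (F X))); last exact: Fmap_hom.
  rewrite -[RHS]free_lift_gen; congr (free_lift _ _ _ p).
  apply: funext => x; rewrite /= hom_foldr_binop; last exact: Fmap_hom.
  under eq_map do rewrite Fmap_gen (pairP _).1.
  rewrite Fmap_gen (pairP _).1.
  exact: (foldr_meet_const (lov_lattice HL (free_in (F X)))).
rewrite (hom_comp_lift _ (free_in (F Y))); last exact: Fmap_hom.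
(* The second projection factors through [alpha]; this is what moves the
   computation from [p] to [q]. *)
have -> : Fmap F eta2 \o a = c \o alpha.
  apply: funext => x; rewrite /= hom_foldr_binop; last exact: Fmap_hom.
  under eq_map do rewrite Fmap_gen (pairP _).2.
  by rewrite Fmap_gen (pairP _).2.
rewrite -free_lift_Fmap pq free_lift_Fmap -[X in le _ _ X]free_lift_gen.
apply: lP => y yl.
have snapy : snap (beta y) y = y by rewrite /snap asboolT.
rewrite -[X in free_gen _ X]snapy /= /c.
exact: (foldr_meet_le lat _
  (fun y' : {classic Y} => free_gen (F Y) (snap (beta y) y'))).
Qed.

(** Under each projection one joinand has the prescribed image and the other
one a smaller image, which the join absorbs. *)
Lemma free_functor_weak_pullback (Q X Y Z : Type) (eta1 : Q -> X)
    (eta2 : Q -> Y) (alpha : X -> Z) (beta : Y -> Z) (p : F X) (q : F Y) :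
  surjective_map alpha -> surjective_map beta ->
  (forall x y, alpha x = beta y -> exists w, eta1 w = x /\ eta2 w = y) ->
  Fmap F alpha p = Fmap F beta q ->
  exists s : F Q, Fmap F eta1 s = p /\ Fmap F eta2 s = q.
Proof.
move=> alpha_onto beta_onto pairs pq.
have [s1 [s1p s1q]] := exact_left_below_right beta_onto pairs pq.
have [|s2 [s2q s2p]] := exact_left_below_right (eta1 := eta2) (eta2 := eta1)
  alpha_onto _ (esym pq).
  by move=> y x /esym/pairs[w [wx wy]]; exists w.
have latX := lov_lattice HL (free_in (F X)).
have latY := lov_lattice HL (free_in (F Y)).
exists (binop join s1 s2); split; rewrite hom_binop; try exact: Fmap_hom.
  by have [[jC _] _ _ _] := latX; rewrite s1p jC; apply/(le_joinP latX).
by rewrite s2q; apply/(le_joinP latY).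
Qed.

End LatticeOrdered.

Theorem theorem12 (S : signature) (L : variety S) (join meet : symbol S)
    (HL : lattice_ordered_variety L join meet)
    (F : forall X : Type, free_algebra L X)
    (X Y Z : Type) (alpha : X -> Z) (beta : Y -> Z)
    (Halpha : surjective_map alpha) (Hbeta : surjective_map beta) :
  is_weak_pullback
    (Fmap F (@Pb1 X Y Z alpha beta)) (Fmap F (@Pb2 X Y Z alpha beta))
    (Fmap F alpha) (Fmap F beta).
Proof.
split=> [|R theta1 theta2 theta12].
  by rewrite -!Fmap_comp; congr Fmap; apply: funext => -[].
have /choice[d dP] : forall r, exists s, Fmap F (@Pb1 X Y Z alpha beta) s =
    theta1 r /\ Fmap F (@Pb2 X Y Z alpha beta) s = theta2 r.
  move=> r; apply: (free_functor_weak_pullback HL Halpha Hbeta) => [x y xy|].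
    by exists (exist (fun p : X * Y => alpha p.1 = beta p.2) (x, y) xy).
  exact: (congr1 (@^~ r) theta12).
by exists d; split; apply: funext => r /=; have [] := dP r.
Qed.
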